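(* Let $G$ be a finitely generated group and $\phi\in\mathrm{End}(G)$. Let $\widehat G$ be the profinite completion of $G$, $\widehat\phi$ the continuous extension of $\phi$ to $\widehat G$, and $j_\phi\colon\mathcal R(\phi)\to\mathcal R(\widehat\phi)$ the map induced by the canonical homomorphism $G\to\widehat G$. For $a,b\in G$ the following are equivalent: (a) $j_\phi([a]_\phi)=j_\phi([b]_\phi)$ in $\mathcal R(\widehat\phi)$; (b) $(q_N)_R([a]_\phi)=(q_N)_R([b]_\phi)$ for every finite observer $N$.
   Context: For an endomorphism $\phi$ of a group $G$, write $a\sim_\phi b$ if $b=ga\phi(g)^{-1}$ for some $g\in G$; $[a]_\phi$ is the class of $a$ and $\mathcal R(\phi)$ the set of classes (same definition for $\widehat\phi$ on $\widehat G$). A finite observer for $(G,\phi)$ is a finite-index normal subgroup $N\triangleleft G$ with $\phi(N)\subseteq N$; $q_N\colon G\to G/N$ is the quotient map, $\bar\phi_N$ the induced endomorphism of $G/N$, and $(q_N)_R\colon\mathcal R(\phi)\to\mathcal R(\bar\phi_N)$, $[a]_\phi\mapsto[q_N(a)]_{\bar\phi_N}$. *)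

(* Defs.v *)
From HB Require Import structures.
From mathcomp Require Import all_boot.
From mathcomp Require Import all_classical topology.

Set Implicit Arguments.
Unset Strict Implicit.
Unset Printing Implicit Defensive.

Local Open Scope group_scope.
Local Open Scope quotient_scope.
Local Open Scope classical_set_scope.

Notation "{ 'ghom' G -> H }" := (UMagmaMorphism.type G%type H%type)
  (at level 0, G at level 98, H at level 99,
   format "{ 'ghom'  G  ->  H }") : type_scope.

(* Subsets of a group are boolean predicates; with the classical axioms of
   boolp every subset is one. *)

Definition finitely_generated (G : groupType) : Prop :=
  exists s : seq G, forall H : {pred G},
    group_closed H -> {subset s <= H} -> forall x, x \in H.

(* Quotients of arbitrary groups; [fingroup] only treats finite groups. *)

Record normal_subgroup (G : groupType) := NormalSubgroup {
  ns_pred :> {pred G};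
  ns_group : group_closed ns_pred;
  ns_conj : forall x y, x \in ns_pred -> x ^ y \in ns_pred
}.

Section NormalSubgroupTheory.
Context {G : groupType} (N : normal_subgroup G).

Lemma ns1 : 1 \in N. Proof. by case: (ns_group N). Qed.

Lemma nsV x : x \in N -> x^-1 \in N.
Proof. exact: (group_closedV (ns_group N)). Qed.

Lemma nsM x y : x \in N -> y \in N -> x * y \in N.
Proof. exact: (group_closedM (ns_group N)). Qed.

Definition coset_rel : rel G := fun x y => x^-1 * y \in N.

Lemma coset_rel_refl : reflexive coset_rel.
Proof. by move=> x; rewrite /coset_rel mulVg ns1. Qed.

Lemma coset_rel_sym : symmetric coset_rel.
Proof.
by move=> x y; apply/idP/idP => /nsV; rewrite /coset_rel invgM invgK.
Qed.

Lemma coset_rel_trans : transitive coset_rel.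
Proof. by move=> y x z /nsM xy /xy; rewrite /coset_rel -mulgA mulVKg. Qed.

Canonical coset_equiv :=
  EquivRel coset_rel coset_rel_refl coset_rel_sym coset_rel_trans.

Definition quot_group : Type := {eq_quot coset_equiv}.

HB.instance Definition _ := Choice.on quot_group.
HB.instance Definition _ := EqQuotient.on quot_group.

Definition quot_proj (x : G) : quot_group := \pi_quot_group x.

Lemma quot_projP x y : quot_proj x = quot_proj y <-> x^-1 * y \in N.
Proof. by split=> [/eqP|h]; [|apply/eqP]; rewrite piE. Qed.

Lemma quot_reprK (u : quot_group) : quot_proj (repr u) = u.
Proof. exact: reprK. Qed.

Definition quot_mul (u v : quot_group) := quot_proj (repr u * repr v).
Definition quot_inv (u : quot_group) := quot_proj (repr u)^-1.

Lemma quot_mulE x y : quot_mul (quot_proj x) (quot_proj y) = quot_proj (x * y).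
Proof.
apply/quot_projP; set x' := repr _; set y' := repr _.
have /quot_projP xx' : quot_proj x' = quot_proj x by exact: quot_reprK.
have /quot_projP yy' : quot_proj y' = quot_proj y by exact: quot_reprK.
have -> : (x' * y')^-1 * (x * y) = (x'^-1 * x) ^ y' * (y'^-1 * y).
  by rewrite invgM conjgE -!mulgA mulVKg.
by rewrite nsM// ns_conj.
Qed.

Lemma quot_invE x : quot_inv (quot_proj x) = quot_proj x^-1.
Proof.
apply/quot_projP; set x' := repr _; rewrite invgK.
have /quot_projP xx' : quot_proj x = quot_proj x' by rewrite quot_reprK.
have -> : x' * x^-1 = (x^-1 * x') ^ x^-1.
  by rewrite conjgE invgK -!mulgA mulVKg.
exact: ns_conj.
Qed.

Lemma quot_mulA : associative quot_mul.
Proof.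
move=> u v w; rewrite -[u]quot_reprK -[v]quot_reprK -[w]quot_reprK.
by rewrite !quot_mulE mulgA.
Qed.

Lemma quot_mul1 : left_id (quot_proj 1) quot_mul.
Proof. by move=> u; rewrite -[u]quot_reprK quot_mulE mul1g. Qed.

Lemma quot_mulr1 : right_id (quot_proj 1) quot_mul.
Proof. by move=> u; rewrite -[u]quot_reprK quot_mulE mulg1. Qed.

Lemma quot_mulV : left_inverse (quot_proj 1) quot_inv quot_mul.
Proof. by move=> u; rewrite -[u]quot_reprK quot_invE quot_mulE mulVg. Qed.

Lemma quot_mulrV : right_inverse (quot_proj 1) quot_inv quot_mul.
Proof. by move=> u; rewrite -[u]quot_reprK quot_invE quot_mulE mulgV. Qed.

HB.instance Definition _ := isGroup.Build quot_group
  quot_mulA quot_mul1 quot_mulr1 quot_mulV quot_mulrV.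

Lemma quot_proj_monoid : monoid_morphism quot_proj.
Proof. by split=> // x y; rewrite -quot_mulE. Qed.

HB.instance Definition _ :=
  isUMagmaMorphism.Build G quot_group quot_proj quot_proj_monoid.

Definition finite_index : Prop := finite_set [set: quot_group].

End NormalSubgroupTheory.

(* The map xM |-> f(x)N; meaningful when f maps M into N. *)
Definition quot_map (G H : groupType) (f : G -> H)
    (M : normal_subgroup G) (N : normal_subgroup H)
    (u : quot_group M) : quot_group N :=
  quot_proj N (f (repr u)).

Lemma quot_mapE (G H : groupType) (f : {ghom G -> H})
    (M : normal_subgroup G) (N : normal_subgroup H) :
  {in M, forall x, f x \in N} ->
  forall x, quot_map f N (quot_proj M x) = quot_proj N (f x).
Proof.
move=> fMN x; apply/quot_projP; rewrite -gmulfV -gmulfM; apply: fMN.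
by apply/quot_projP; rewrite quot_reprK.
Qed.

Lemma quot_map_monoid (G H : groupType) (f : {ghom G -> H})
    (M : normal_subgroup G) (N : normal_subgroup H) :
  {in M, forall x, f x \in N} -> monoid_morphism (quot_map f N : quot_group M -> _).
Proof.
move=> fMN; split=> [|u v]; first by rewrite quot_mapE// gmulf1.
rewrite -[u]quot_reprK -[v]quot_reprK -gmulfM !quot_mapE//.
by rewrite gmulfM gmulfM.
Qed.

Section Reidemeister.
Context {G : groupType} (phi : {ghom G -> G}).

Definition twisted_conj (a b : G) : Prop :=
  exists g, b = g * a * (phi g)^-1.

Definition twisted_rel : rel G := fun a b => `[< twisted_conj a b >].

Lemma twisted_rel_refl : reflexive twisted_rel.
Proof. by move=> a; apply/asboolP; exists 1; rewrite gmulf1 mul1g divg1. Qed.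

Lemma twisted_conj_sym a b : twisted_conj a b -> twisted_conj b a.
Proof.
by case=> g ->; exists g^-1; rewrite gmulfV invgK !mulgA mulVg mul1g mulgVK.
Qed.

Lemma twisted_rel_sym : symmetric twisted_rel.
Proof.
by move=> a b; apply/asboolP/asboolP; exact: twisted_conj_sym.
Qed.

Lemma twisted_rel_trans : transitive twisted_rel.
Proof.
move=> b a c /asboolP[g ->] /asboolP[h ->]; apply/asboolP.
by exists (h * g); rewrite gmulfM invgM !mulgA.
Qed.

Canonical twisted_equiv :=
  EquivRel twisted_rel twisted_rel_refl twisted_rel_sym twisted_rel_trans.

Definition reidemeister : Type := {eq_quot twisted_equiv}.

HB.instance Definition _ := Choice.on reidemeister.
HB.instance Definition _ := EqQuotient.on reidemeister.

Definition twisted_class (a : G) : reidemeister := \pi_reidemeister a.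

Lemma twisted_classP a b :
  twisted_class a = twisted_class b <-> twisted_conj a b.
Proof.
by split=> [/eqP|h]; [|apply/eqP]; rewrite piE => *; apply/asboolP.
Qed.

End Reidemeister.

(* The map [a]_phi |-> [f(a)]_psi; well defined when f intertwines phi and
   psi, as reid_mapE shows. *)
Definition reid_map (G H : groupType) (phi : {ghom G -> G})
    (psi : {ghom H -> H}) (f : G -> H) (C : reidemeister phi) :
    reidemeister psi :=
  twisted_class psi (f (repr C)).

Lemma reid_mapE (G H : groupType) (phi : {ghom G -> G})
    (psi : {ghom H -> H}) (f : {ghom G -> H}) :
  (forall x, psi (f x) = f (phi x)) ->
  forall a, reid_map psi f (twisted_class phi a) = twisted_class psi (f a).
Proof.
move=> fE a; apply/twisted_classP.
have /twisted_classP[g ga] :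
  twisted_class phi (repr (twisted_class phi a)) = twisted_class phi a.
  exact: reprK.
by exists (f g); rewrite fE -gmulfV -!gmulfM -ga.
Qed.

Record finite_observer (G : groupType) (phi : {ghom G -> G}) :=
  FiniteObserver {
    obs_ns :> normal_subgroup G;
    obs_fin : finite_index obs_ns;
    obs_stable : {in obs_ns, forall x, phi x \in obs_ns}
  }.

Section Observer.
Context {G : groupType} {phi : {ghom G -> G}} (N : finite_observer phi).

Definition induced_endo : quot_group N -> quot_group N := quot_map phi N.

HB.instance Definition _ := isUMagmaMorphism.Build _ _ induced_endo
  (quot_map_monoid (@obs_stable _ _ N)).

Definition obs_reid_map : reidemeister phi -> reidemeister induced_endo :=
  reid_map induced_endo (quot_proj N).

Lemma obs_reid_mapE a :
  obs_reid_map (twisted_class phi a) =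
  twisted_class induced_endo (quot_proj N a).
Proof.
by apply: reid_mapE => x; rewrite /= /induced_endo quot_mapE//;
  exact: obs_stable.
Qed.

End Observer.

(* Profinite completion: the inverse limit of the finite quotients G/N,    *)
(* as a topological subspace of the product of the discrete groups G/N.    *)

Record fi_normal (G : groupType) := FiNormal {
  fi_ns :> normal_subgroup G;
  fi_fin : finite_index fi_ns
}.

HB.instance Definition _ (G : groupType) := gen_eqMixin (fi_normal G).
HB.instance Definition _ (G : groupType) := gen_choiceMixin (fi_normal G).

Section ProfiniteCompletion.
Context {G : groupType}.

Definition fi_prod : Type :=
  prod_topology (fun N : fi_normal G => discrete_topology (quot_group N)).

HB.instance Definition _ := Topological.on fi_prod.

Definition fi_prod_one : fi_prod := fun N => (1 : quot_group N).
Definition fi_prod_mul (x y : fi_prod) : fi_prod :=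
  fun N => (x N : quot_group N) * (y N : quot_group N).
Definition fi_prod_inv (x : fi_prod) : fi_prod :=
  fun N => (x N : quot_group N)^-1.

Lemma fi_prod_mulA : associative fi_prod_mul.
Proof. by move=> x y z; apply: functional_extensionality_dep => N; exact: mulgA. Qed.
Lemma fi_prod_mul1 : left_id fi_prod_one fi_prod_mul.
Proof. by move=> x; apply: functional_extensionality_dep => N; exact: mul1g. Qed.
Lemma fi_prod_mulr1 : right_id fi_prod_one fi_prod_mul.
Proof. by move=> x; apply: functional_extensionality_dep => N; exact: mulg1. Qed.
Lemma fi_prod_mulV : left_inverse fi_prod_one fi_prod_inv fi_prod_mul.
Proof. by move=> x; apply: functional_extensionality_dep => N; exact: mulVg. Qed.
Lemma fi_prod_mulrV : right_inverse fi_prod_one fi_prod_inv fi_prod_mul.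
Proof. by move=> x; apply: functional_extensionality_dep => N; exact: mulgV. Qed.

HB.instance Definition _ := isGroup.Build fi_prod
  fi_prod_mulA fi_prod_mul1 fi_prod_mulr1 fi_prod_mulV fi_prod_mulrV.

Definition compatible : set fi_prod :=
  [set x | forall M N : fi_normal G, {subset M <= N} ->
             quot_map idfun N (x M : quot_group M) = x N].

End ProfiniteCompletion.

Definition profinite (G : groupType) : Type := set_type (@compatible G).

Section ProfiniteGroup.
Context {G : groupType}.

HB.instance Definition _ := Topological.on (profinite G).

Lemma compatible_group : group_closed (fun x : @fi_prod G => x \in compatible).
Proof.
split=> [|x y /set_mem cx /set_mem cy]; apply/mem_set => M N MN.
  by rewrite (quot_mapE (f := idfun)).
rewrite -[LHS]/(quot_map idfun N ((x M : quot_group M) / (y M : quot_group M))).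
rewrite -[RHS]/((x N : quot_group N) / (y N : quot_group N)).
rewrite -(cx _ _ MN) -(cy _ _ MN).
rewrite -[x M : quot_group M]quot_reprK -[y M : quot_group M]quot_reprK.
by rewrite -gmulfF !(quot_mapE (f := idfun))// -gmulfF.
Qed.

HB.instance Definition _ := SubChoice.on (profinite G).
HB.instance Definition _ :=
  SubChoice_isSubGroup.Build _ _ (profinite G) compatible_group.

Definition profinite_coord (N : fi_normal G) (x : profinite G) : quot_group N :=
  (val x : fi_prod) N.

Lemma profinite_coord_inj (x y : profinite G) :
  (forall N, profinite_coord N x = profinite_coord N y) -> x = y.
Proof. by move=> xy; apply/val_inj/functional_extensionality_dep. Qed.

Lemma profinite_coord_monoid N : monoid_morphism (profinite_coord N).
Proof. by split. Qed.

HB.instance Definition _ N := isUMagmaMorphism.Build _ _ (profinite_coord N)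
  (profinite_coord_monoid N).

Lemma profinite_coordE (x : profinite G) (M N : fi_normal G) :
  {subset M <= N} ->
  quot_map idfun N (profinite_coord M x) = profinite_coord N x.
Proof. exact: (set_valP x). Qed.

Lemma profinite_coord_continuous (N : fi_normal G) :
  continuous (profinite_coord N : profinite G -> discrete_topology (quot_group N)).
Proof.
move=> x; apply: (@continuous_comp (profinite G) fi_prod _ val (fun f => f N)).
  exact: initial_continuous.
exact: (@proj_continuous _
  (fun N : fi_normal G => discrete_topology (quot_group N)) N).
Qed.

Lemma continuous_profinite (T : topologicalType) (f : T -> profinite G) :
  (forall N : fi_normal G, continuous
    (profinite_coord N \o f : T -> discrete_topology (quot_group N))) ->
  continuous f.
Proof.
move=> fc; apply/continuous_comp_initial => x; apply/cvg_sup => N.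
exact: (@continuous_comp_initial fi_prod T
  (discrete_topology (quot_group N)) (fun p => p N) (val \o f) (fc N)).
Qed.

Definition profinite_embed_fun (g : G) : fi_prod := fun N => quot_proj N g.

Lemma profinite_embed_compatible g : compatible (profinite_embed_fun g).
Proof. by move=> M N MN; rewrite (quot_mapE (f := idfun)). Qed.

Definition profinite_embed (g : G) : profinite G :=
  exist _ (profinite_embed_fun g) (mem_set (profinite_embed_compatible g)).

Lemma profinite_embed_monoid : monoid_morphism profinite_embed.
Proof.
split=> [|x y]; apply: profinite_coord_inj => N.
  by rewrite gmulf1 -[LHS]/(quot_proj N 1) gmulf1.
by rewrite gmulfM -[LHS]/(quot_proj N (x * y)) gmulfM.
Qed.

HB.instance Definition _ := isUMagmaMorphism.Build G (profinite G)
  profinite_embed profinite_embed_monoid.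

End ProfiniteGroup.

Section ContinuousExtension.
Context {G : groupType} (phi : {ghom G -> G}).

Definition continuous_extension
    (phihat : {ghom profinite G -> profinite G}) : Prop :=
  continuous phihat /\
  forall g : G, phihat (profinite_embed g) = profinite_embed (phi g).

Definition profinite_reid_map (phihat : {ghom profinite G -> profinite G}) :
    reidemeister phi -> reidemeister phihat :=
  reid_map phihat profinite_embed.

Lemma profinite_reid_mapE phihat a : continuous_extension phihat ->
  profinite_reid_map phihat (twisted_class phi a) =
  twisted_class phihat (profinite_embed a).
Proof. by case=> _ ext; exact: reid_mapE. Qed.

(* Existence of the continuous extension: the N-coordinate of the image of x
   is read off from the coordinate of x at the preimage of N. *)

Lemma preim_group_closed (N : normal_subgroup G) :
  group_closed [pred x | phi x \in N].
Proof.
split=> [|x y]; rewrite !inE ?gmulf1 ?ns1// => xN yN.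
by rewrite gmulfF; apply: nsM => //; apply: nsV.
Qed.

Lemma preim_conj (N : normal_subgroup G) x y :
  x \in [pred x | phi x \in N] -> x ^ y \in [pred x | phi x \in N].
Proof. by rewrite !inE gmulfJ; exact: ns_conj. Qed.

Definition preim_normal (N : normal_subgroup G) : normal_subgroup G :=
  NormalSubgroup (preim_group_closed N) (@preim_conj N).

Lemma preim_normal_sub (N : normal_subgroup G) :
  {in preim_normal N, forall x, phi x \in N}.
Proof. by []. Qed.

Lemma preim_fin (N : fi_normal G) : finite_index (preim_normal N).
Proof.
have inj : injective (quot_map phi N : quot_group (preim_normal N) -> _).
  move=> u v; rewrite -[u]quot_reprK -[v]quot_reprK.
  rewrite !(quot_mapE (@preim_normal_sub N)) => /quot_projP uv.
  by apply/quot_projP; rewrite inE gmulfM gmulfV.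
apply: (@sub_finite_set _ _ (quot_map phi N @^-1` setT)) => //.
by apply: finite_preimage (fi_fin N) => ? ? _ _; exact: inj.
Qed.

Definition preim_fi (N : fi_normal G) : fi_normal G := FiNormal (preim_fin N).

Definition profinite_map_fun (x : profinite G) : fi_prod :=
  fun N => quot_map phi N (profinite_coord (preim_fi N) x).

Lemma profinite_map_compatible x : compatible (profinite_map_fun x).
Proof.
move=> M N MN; rewrite /profinite_map_fun.
have sub : {subset preim_fi M <= preim_fi N} by move=> z; exact: MN.
rewrite -(profinite_coordE x sub).
rewrite -[profinite_coord _ x]quot_reprK.
by rewrite (quot_mapE (@preim_normal_sub M)) !(quot_mapE (f := idfun))//
  (quot_mapE (@preim_normal_sub N)).
Qed.

Definition profinite_map (x : profinite G) : profinite G :=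
  exist _ (profinite_map_fun x) (mem_set (profinite_map_compatible x)).

Lemma profinite_map_monoid : monoid_morphism profinite_map.
Proof.
split=> [|x y]; apply: profinite_coord_inj => N.
  rewrite gmulf1 -[LHS]/(quot_map phi N (profinite_coord (preim_fi N) 1)).
  by rewrite gmulf1 (quot_map_monoid (@preim_normal_sub N)).
rewrite gmulfM.
rewrite -[LHS]/(quot_map phi N (profinite_coord (preim_fi N) (x * y))).
by rewrite gmulfM (quot_map_monoid (@preim_normal_sub N)).
Qed.

HB.instance Definition _ := isUMagmaMorphism.Build _ _ profinite_map
  profinite_map_monoid.

Lemma profinite_map_extension : continuous_extension profinite_map.
Proof.
split=> [|g]; last first.
  apply: profinite_coord_inj => N.
  exact: (quot_mapE (@preim_normal_sub N)).
apply: continuous_profinite => N x.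
apply: (@continuous_comp _ (discrete_topology (quot_group (preim_fi N)))
  (discrete_topology (quot_group N)) (profinite_coord (preim_fi N))
  (quot_map phi N)).
  exact: profinite_coord_continuous.
move=> A /nbhs_singleton Au; apply: filterS (discrete_set1 _) => _ ->.
exact: Au.
Qed.

End ContinuousExtension.

(* Main.v *)
(** The implication (a) => (b) holds because the continuous extension is
    determined on every finite quotient by [phi], the image of [G] being dense.
    For the converse, finite generation forces the homomorphisms
    [q_N \o phi^k : G -> G/N] to repeat, so that a finite intersection of the
    subgroups [phi^-k(N)] is a finite observer inside [N].  Hence, modulo every
    finite-index normal subgroup, the equation [b = g a phi(g)^-1] has a
    solution; an ultrafilter containing all these solution sets converges in
    each finite quotient, and its limit conjugates [a] to [b] in the
    completion. *)
Require Import Defs.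
From HB Require Import structures.
From mathcomp Require Import all_boot.
From mathcomp Require Import all_classical topology.

Set Implicit Arguments.
Unset Strict Implicit.
Unset Printing Implicit Defensive.

Local Open Scope group_scope.
Local Open Scope classical_set_scope.

(** * Finite-index normal subgroups under intersection *)

Section NormalIntersection.
Context {G : groupType}.

Lemma cap_group_closed (M N : normal_subgroup G) :
  group_closed [pred x | (x \in M) && (x \in N)].
Proof.
split=> [|x y]; rewrite !inE ?ns1// => /andP[xM xN] /andP[yM yN].
by rewrite !nsM ?nsV.
Qed.

Lemma cap_conj (M N : normal_subgroup G) x y :
  x \in [pred x | (x \in M) && (x \in N)] ->
  x ^ y \in [pred x | (x \in M) && (x \in N)].
Proof. by rewrite !inE => /andP[xM xN]; rewrite !ns_conj. Qed.

Definition cap_normal (M N : normal_subgroup G) : normal_subgroup G :=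
  NormalSubgroup (cap_group_closed M N) (@cap_conj M N).

Lemma cap_normalE (M N : normal_subgroup G) x :
  (x \in cap_normal M N) = (x \in M) && (x \in N).
Proof. by []. Qed.

(** The diagonal map embeds the quotient by the intersection into the product of the two finite
    quotients. *)
Lemma cap_fin (M N : fi_normal G) : finite_index (cap_normal M N).
Proof.
pose f (u : quot_group (cap_normal M N)) : quot_group M * quot_group N :=
  (quot_proj M (repr u), quot_proj N (repr u)).
have f_inj : injective f.
  move=> u v [/quot_projP uvM /quot_projP uvN].
  rewrite -[u]quot_reprK -[v]quot_reprK; apply/quot_projP.
  by rewrite cap_normalE uvM.
have fin : finite_set (setT `*` setT : set (quot_group M * quot_group N)).
  by apply: finite_setX; exact: fi_fin.
apply: (@sub_finite_set _ _ (f @^-1` (setT `*` setT))) => //.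
by apply: finite_preimage fin => ? ? _ _; exact: f_inj.
Qed.

Definition cap_fi (M N : fi_normal G) : fi_normal G := FiNormal (cap_fin M N).

Lemma cap_fiE (M N : fi_normal G) x :
  (x \in cap_fi M N) = (x \in M) && (x \in N).
Proof. by []. Qed.

Lemma setT_normal_closed : group_closed (predT : {pred G}).
Proof. by []. Qed.

Definition setT_normal : normal_subgroup G :=
  NormalSubgroup setT_normal_closed (fun x y _ => isT).

Lemma setT_normal_fin : finite_index setT_normal.
Proof.
apply: (@sub_finite_set _ _ [set 1]) (finite_set1 _) => u _ /=.
by rewrite -[u]quot_reprK; apply/quot_projP.
Qed.

Definition setT_fi : fi_normal G := FiNormal setT_normal_fin.

(** Intersections make the finite-index normal subgroups a directed family, so any monotone family
    of nonempty sets over it is a filter base. *)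
Lemma filter_from_fi_proper (B : fi_normal G -> set G) :
  (forall M N : fi_normal G, {subset M <= N} -> B M `<=` B N) ->
  (forall N, B N !=set0) -> ProperFilter (filter_from setT B).
Proof.
move=> B_mono B_ne; apply: filter_from_proper => [|N _]; last exact: B_ne.
apply: filter_from_filter => [|M N _ _]; first by exists setT_fi.
by exists (cap_fi M N) => // g Bg; split; apply: B_mono Bg => x;
  rewrite cap_fiE => /andP[].
Qed.

End NormalIntersection.

(** * Construction of finite observers *)

Section Observers.
Context {G : groupType} (phi : {ghom G -> G}).

Lemma iter_monoid_morphism k : monoid_morphism (iter k phi).
Proof.
elim: k => [//|k [IH1 IHM]]; split=> [|x y] /=; first by rewrite IH1 gmulf1.
by rewrite IHM gmulfM.
Qed.

HB.instance Definition _ k :=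
  isUMagmaMorphism.Build G G (iter k phi) (iter_monoid_morphism k).

(** The intersection of [phi^-i(N)] for [i <= k], built recursively so that finite index and
    normality are inherited at each stage. *)
Fixpoint orbit_fi (N : fi_normal G) k : fi_normal G :=
  if k is k'.+1 then cap_fi N (preim_fi phi (orbit_fi N k')) else N.

Lemma orbit_fiP (N : fi_normal G) k x :
  reflect (forall i, i <= k -> iter i phi x \in N) (x \in orbit_fi N k).
Proof.
elim: k x => [|k IH] x.
  by apply: (iffP idP) => [xN [] //|xN]; exact: (xN 0).
apply: (iffP andP) => [[xN /IH pxN] [//|i] ik|xN].
  by rewrite iterSr; exact: pxN.
split; first exact: (xN 0).
by apply/IH => i ik; rewrite -iterSr; exact: xN.
Qed.

Lemma finite_seq_size (T : Type) n :
  finite_set [set: T] -> finite_set [set t : seq T | size t = n].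
Proof.
move=> finT; elim: n => [|n IH].
  by apply: sub_finite_set (finite_set1 [::]) => t /= /size0nil.
apply: sub_finite_set
  (finite_image (fun p : T * seq T => p.1 :: p.2) (finite_setX finT IH)).
by case=> [//|x t] /= [tn]; exists (x, t).
Qed.

(** Pigeonhole: a homomorphism to the finite group [G/N] is determined by its values on the
    generators, so there are only finitely many. The larger exponent is written [l.+1] so that [i]
    falls in the range covered by [orbit_fi N l]. *)
Lemma iter_eq_mod (N : fi_normal G) : finitely_generated G ->
  exists i l, i <= l /\
    forall x, quot_proj N (iter i phi x) = quot_proj N (iter l.+1 phi x).
Proof.
case=> s gen; pose f k := [seq quot_proj N (iter k phi x) | x <- s].
have [i [j [ij fij]]] : exists i j, i < j /\ f i = f j.
  apply: contrapT => nf; apply: infinite_nat.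
  have f_inj : injective f.
    move=> i j fij; case: (ltngtP i j) => // ij; case: nf.
      by exists i, j.
    by exists j, i.
  have fin := finite_seq_size (size s) (fi_fin N).
  apply: (@sub_finite_set _ _ (f @^-1` [set t | size t = size s])).
    by move=> k _; rewrite /= size_map.
  by apply: finite_preimage fin => ? ? _ _; exact: f_inj.
case: j => // l in ij fij; exists i, l; split=> // x.
(* The elements on which two homomorphisms agree form a subgroup, here one containing the
   generators. *)
apply/eqP; apply: (gen [pred x | quot_proj N (iter i phi x) ==
                                 quot_proj N (iter l.+1 phi x)]).
  split=> [|y z]; rewrite !inE ?gmulf1// => /eqP ey /eqP ez.
  have divE k : quot_proj N (iter k phi (y / z)) =
      quot_proj N (iter k phi y) / quot_proj N (iter k phi z).
    by rewrite !gmulfF.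
  by rewrite (divE i) (divE l.+1) ey ez.
by move=> y ys; rewrite inE; apply/eqP; move/eq_in_map: fij; exact.
Qed.

Lemma observer_sub (N : fi_normal G) : finitely_generated G ->
  exists M : finite_observer phi, {subset M <= N}.
Proof.
move=> /(iter_eq_mod N)[i [l [il eqN]]].
have st : {in orbit_fi N l, forall x, phi x \in orbit_fi N l}.
  move=> x /orbit_fiP xN; apply/orbit_fiP => k.
  rewrite leq_eqVlt -iterSr => /orP[/eqP->|]; last exact: xN.
  (* The only new condition is [k = l.+1], and modulo [N] that iterate agrees with the [i]-th, which
     lies in [N]. *)
  have /quot_projP := eqN x; move=> /(nsM (xN i il)); by rewrite mulVKg.
by exists (FiniteObserver (fi_fin (orbit_fi N l)) st) => x /orbit_fiP/(_ 0); exact.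
Qed.

Lemma obs_reid_eqP (N : finite_observer phi) a b :
  obs_reid_map N (twisted_class phi a) = obs_reid_map N (twisted_class phi b)
  <-> exists g, quot_proj N b = quot_proj N (g * a * (phi g)^-1).
Proof.
have ind x : induced_endo (quot_proj N x) = quot_proj N (phi x).
  by apply: quot_mapE; exact: obs_stable.
rewrite !obs_reid_mapE; split=> [/twisted_classP[u bE]|[g bE]].
  exists (repr u); rewrite bE -{1 2}[u]quot_reprK.
  by rewrite !gmulfM gmulfV /= ind.
apply/twisted_classP; exists (quot_proj N g).
by rewrite bE !gmulfM gmulfV /= ind.
Qed.

End Observers.

(** * Elements of the completion as limits of elements of [G] *)

Section Approximation.
Context {G : groupType}.

Definition approx (z : profinite G) (N : fi_normal G) : set G :=
  [set g | quot_proj N g = profinite_coord N z].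

Lemma approx_mono z (M N : fi_normal G) :
  {subset M <= N} -> approx z M `<=` approx z N.
Proof.
move=> MN g; rewrite /approx /= -(profinite_coordE z MN) => <-.
by rewrite (quot_mapE (f := idfun)).
Qed.

Lemma approx_nonempty z N : approx z N !=set0.
Proof. by exists (repr (profinite_coord N z)); exact: quot_reprK. Qed.

#[local] Instance approx_filter z : ProperFilter (filter_from setT (approx z)).
Proof.
by apply: filter_from_fi_proper; [exact: approx_mono|exact: approx_nonempty].
Qed.

Lemma approx_in z N : filter_from setT (approx z) (approx z N).
Proof. by exists N. Qed.

Lemma approx2 z M N : (approx z M `&` approx z N) !=set0.
Proof. exact: filter_ex (filterI (approx_in z M) (approx_in z N)). Qed.

(** Density of [G] in its completion: near [z], only finitely many coordinates have to be
    matched. *)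
Lemma embed_approx_cvg z :
  profinite_embed @ filter_from setT (approx z) --> z.
Proof.
move=> U [/= _ [[W oW <-]] Wz /filterS]; apply.
have : (val \o profinite_embed) @ filter_from setT (approx z) --> (val z : fi_prod).
  apply/cvg_sup => N A [/= _ [[V oV <-]] Vz /filterS]; apply.
  exists N => // g; rewrite /approx /= => gz.
  by rewrite -[X in V X]/(quot_proj N g) gz.
by apply; exact: open_nbhs_nbhs.
Qed.

(** Uniqueness of the extension: singletons are open in [G/N], so by continuity the coordinate at
    [z] is already attained at nearby elements of [G], where [phihat] is [phi]. *)
Lemma coord_continuous_extension (phi : {ghom G -> G})
    (phihat : {ghom profinite G -> profinite G}) :
  continuous_extension phi phihat ->
  forall z N, profinite_coord N (phihat z) =
              quot_map phi N (profinite_coord (preim_fi phi N) z).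
Proof.
move=> [phihatC phihatE] z N.
have Fz : filter_from setT (approx z) [set g |
    profinite_coord N (phihat (profinite_embed g)) = profinite_coord N (phihat z)].
  exact: @embed_approx_cvg z _ (phihatC z _
  (profinite_coord_continuous (discrete_set1 (profinite_coord N (phihat z) :
     discrete_topology (quot_group N))))).
have [g [/= gz gz']] := filter_ex (filterI Fz (approx_in z (preim_fi phi N))).
by rewrite -gz -gz' (quot_mapE (@preim_normal_sub _ phi N)) phihatE.
Qed.

(** Two approximations enter because the [N]-coordinate of [phihat z] is read from [z] at
    [phi^-1(N)]. *)
Lemma coord_twisted (phi : {ghom G -> G})
    (phihat : {ghom profinite G -> profinite G}) z (N : fi_normal G) a g :
  continuous_extension phi phihat ->
  approx z N g -> approx z (preim_fi phi N) g ->
  profinite_coord N (z * profinite_embed a / phihat z) =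
  quot_proj N (g * a / phi g).
Proof.
move=> ext gN gpN.
have divE w : profinite_coord N (z * profinite_embed a / w) =
    profinite_coord N z * quot_proj N a / profinite_coord N w.
  by rewrite !gmulfM gmulfV.
rewrite divE (coord_continuous_extension ext) -gN -gpN.
by rewrite (quot_mapE (@preim_normal_sub _ phi N)) !gmulfM gmulfV.
Qed.

(** The pushforward to the compact space [G/N] clusters at some [u]. If the fibre over [u] were not
    in [F], its complement would be, and the open set [[set u]] would have to meet the complement of
    [u]. *)
Lemma ultrafilter_coord (F : set_system G) (N : fi_normal G) :
  UltraFilter F -> exists u : quot_group N, F [set g | quot_proj N g = u].
Proof.
move=> FU.
pose T : topologicalType := discrete_topology (quot_group N).
have cT : compact [set: T] by apply: finite_compact; exact: (fi_fin N).
have [u [_ Fu]] := cT ((quot_proj N : G -> T) @ F) _ filterT.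
exists u; have [//|FuC] := in_ultra_setVsetC [set g | quot_proj N g = u] FU.
have [v [/= vC vu]] := Fu [set~ u] [set u] FuC (discrete_set1 u).
by case: vC.
Qed.

Lemma ultrafilter_profinite (F : set_system G) :
  UltraFilter F -> exists z : profinite G, forall N, F (approx z N).
Proof.
move=> FU; pose z (N : fi_normal G) := sval (cid (ultrafilter_coord N FU)).
have Fz (N : fi_normal G) : F [set g | quot_proj N g = z N].
  exact: (svalP (cid (ultrafilter_coord N FU))).
have zc : compatible (z : fi_prod).
  (* Two sets of [F] meet, so a single [g] represents both coordinates. *)
  move=> M N MN; have [g [/= gM gN]] := filter_ex (filterI (Fz M) (Fz N)).
  by rewrite -gM -gN (quot_mapE (f := idfun)).
by exists (exist _ (z : fi_prod) (mem_set zc)).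
Qed.

End Approximation.

Theorem theorem4p2 (G : groupType) (phi : {ghom G -> G})
    (phihat : {ghom profinite G -> profinite G}) (a b : G) :
  finitely_generated G ->
  continuous_extension phi phihat ->
  profinite_reid_map phihat (twisted_class phi a) =
  profinite_reid_map phihat (twisted_class phi b)
  <->
  (forall N : finite_observer phi,
     obs_reid_map N (twisted_class phi a) =
     obs_reid_map N (twisted_class phi b)).
Proof.
move=> fg ext; rewrite !profinite_reid_mapE//; split=> [/twisted_classP[z bE] N|ab].
  apply/obs_reid_eqP; pose N' := FiNormal (obs_fin N).
  have [g [gN gpN]] := approx2 z N' (preim_fi phi N').
  exists g; rewrite -[LHS]/(profinite_coord N' (profinite_embed b)) bE.
  exact: (coord_twisted (N := N') a ext gN gpN).
pose sol (N : fi_normal G) :=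
  [set g | quot_proj N b = quot_proj N (g * a * (phi g)^-1)].
have sol_mono (M N : fi_normal G) : {subset M <= N} -> sol M `<=` sol N.
  by move=> MN g /quot_projP /MN ?; exact/quot_projP.
have sol_ne N : sol N !=set0.
  (* Condition (b) gives solutions only modulo observers; a solution modulo one inside [N] is also a
     solution modulo [N]. *)
  have [M MN] := observer_sub phi N fg.
  have [g gM] := (obs_reid_eqP M a b).1 (ab M).
  by exists g; apply: (sol_mono (FiNormal (obs_fin M)) _ MN).
have [F [FU solF]] := ultraFilterLemma (filter_from_fi_proper sol_mono sol_ne).
have [z Fz] := ultrafilter_profinite FU.
apply/twisted_classP; exists z; apply: profinite_coord_inj => N.
have Fsol : F (sol N) by apply: solF; exists N.
(* One [g] solves the equation modulo [N] and also represents [z] at both coordinates that the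
   twisted conjugate involves. *)
have [g [gsol [gN gpN]]] :=
  filter_ex (filterI Fsol (filterI (Fz N) (Fz (preim_fi phi N)))).
by rewrite (coord_twisted _ ext gN gpN).
Qed.
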